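(* Let $i, j$ be integers. There exists $n \geq 0$ with $s(n) = i$ and $s(n+1) = j$ if and only if at least one of the following holds: (a) $i > 0$ and $-i \leq j \leq i-1$; (b) $j \geq 1$, $1-j \leq i \leq j+1$, and $i \not\equiv j \pmod 2$; (c) $j \leq -2$, $j+2 \leq i \leq -j-2$, and $i \equiv j \pmod 2$.
   Context: The infinity series $(s(n))_{n \geq 0}$ is the integer sequence defined by $s(0)=0$, $s(2n) = -s(n)$ for $n \geq 1$, and $s(2n+1) = s(n)+1$ for $n \geq 0$. *)

(* Defs.v *)
From mathcomp Require Import all_boot all_order all_algebra.

Set Implicit Arguments.
Unset Strict Implicit.
Unset Printing Implicit Defensive.

Import Order.TTheory GRing.Theory Num.Theory.
Local Open Scope ring_scope.

(* [k] bounds the recursion depth: the value at [m] does not depend on [k] as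
   soon as [m <= k], since [m./2 < m] for [m > 0]. *)
Fixpoint infinity_series_rec (k m : nat) : int :=
  if k is k'.+1 then
    if m == 0%N then 0
    else if odd m then infinity_series_rec k' m./2 + 1
    else - infinity_series_rec k' m./2
  else 0.

Definition infinity_series (n : nat) : int := infinity_series_rec n n.

Lemma infinity_series_rec_stable (k l m : nat) :
  (m <= k)%N -> (m <= l)%N ->
  infinity_series_rec k m = infinity_series_rec l m.
Proof.
elim: k l m => [|k IHk] [|l] m //=; rewrite ?leqn0.
- by move=> ->.
- by move=> _ ->.
move=> mk ml; case: eqP => // /eqP m0.
have lt_m : (m./2 < m)%N by rewrite -divn2 ltn_Pdiv // lt0n.
by rewrite (IHk l) // -ltnS; apply: leq_trans lt_m _.
Qed.

Lemma infinity_series0 : infinity_series 0 = 0.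
Proof. by []. Qed.

Lemma infinity_series_half (n : nat) :
  (0 < n)%N ->
  infinity_series n =
    if odd n then infinity_series n./2 + 1 else - infinity_series n./2.
Proof.
case: n => // n _; rewrite /infinity_series.
rewrite -(@infinity_series_rec_stable n n.+1./2 n.+1./2) //.
by rewrite -ltnS -divn2 ltn_Pdiv.
Qed.

Lemma infinity_series_double (n : nat) :
  (0 < n)%N -> infinity_series (2 * n) = - infinity_series n.
Proof.
move=> n_gt0; rewrite infinity_series_half ?muln_gt0 //.
by rewrite mul2n odd_double doubleK.
Qed.

Lemma infinity_series_doubleS (n : nat) :
  infinity_series (2 * n + 1) = infinity_series n + 1.
Proof.
rewrite addn1 infinity_series_half // mul2n.
by rewrite oddS odd_double /= uphalf_double.
Qed.

(* Main.v *)
(** If [(a, b)] are the values of [s] at [m] and [m + 1], then the consecutive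
    values at [2m] are [(- a, a + 1)] and those at [2m + 1] are [(a + 1, - b)].
    As [s] is onto, the pairs at even indices are exactly those with sum [1], and
    the others arise by iterating [(a, b) |-> (a + 1, - b)]. Hence [(i, j)] occurs
    iff undoing this map [k] times, for some [k >= 0], gives a pair
    [(i - k, (-1)^k j)] with sum [1]. *)

Require Import Defs.
From mathcomp Require Import all_boot all_order all_algebra.
From mathcomp Require Import zify.

Import Order.TTheory GRing.Theory Num.Theory.
Local Open Scope ring_scope.

Lemma infinity_series_pair_even (m : nat) :
  infinity_series (2 * m) = - infinity_series m /\
  infinity_series (2 * m).+1 = infinity_series m + 1.
Proof.
split; last by rewrite -(addn1 (2 * m)) infinity_series_doubleS.
(* The doubling rule needs a positive index; at [m = 0] both sides are [0]. *)
by case: m => [|m] //; rewrite infinity_series_double.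
Qed.

Lemma infinity_series_pair_odd (m : nat) :
  infinity_series (2 * m).+1 = infinity_series m + 1 /\
  infinity_series (2 * m).+2 = - infinity_series m.+1.
Proof.
split; first by rewrite -(addn1 (2 * m)) infinity_series_doubleS.
by rewrite -infinity_series_double // mulnS.
Qed.

(** Iterating [n |-> 2n + 1] from [1] reaches every positive value, and one doubling then negates
    it; [surj_nat] keeps the index positive for that doubling. *)
Lemma infinity_series_surj (z : int) : exists n, infinity_series n = z.
Proof.
have surj_nat k : exists n, infinity_series n.+1 = k.+1%:Z.
  elim: k => [|k [n sn]]; first by exists 0%N.
  by exists (2 * n.+1)%N; rewrite (infinity_series_pair_even n.+1).2 sn; lia.
case: z => [[|k]|k].
- by exists 0%N.
- by have [n sn] := surj_nat k; exists n.+1.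
have [n sn] := surj_nat k.
by exists (2 * n.+1)%N; rewrite infinity_series_double // sn NegzE.
Qed.

Lemma infinity_series_pairP (i j : int) :
  (exists n : nat, infinity_series n = i /\ infinity_series n.+1 = j) <->
  (exists k : nat, i + (-1) ^+ k * j = k.+1%:Z).
Proof.
split=> [[n [<- <-]]|[k]].
  elim/ltn_ind: n => n IHn; have := odd_double_half n.
  rewrite -mul2n; case: (odd n) => /= def_n.
    have [|k IHk] := IHn n./2; first by lia.
    exists k.+1; rewrite -def_n add1n.
    have [-> ->] := infinity_series_pair_odd n./2.
    by rewrite exprS mulN1r mulrNN addrAC IHk intS addrC.
  exists 0%N; rewrite -def_n add0n.
  have [-> ->] := infinity_series_pair_even n./2.
  by rewrite expr0 mul1r addKr.
elim: k i j => [|k IHk] i j.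
  rewrite expr0 mul1r => sum_ij.
  (* At index [2m] the pair is [(- s(m), s(m) + 1)], and here [j = 1 - i], so [s(m) = - i] is what
     is needed. *)
  have [m sm] := infinity_series_surj (- i).
  exists (2 * m)%N; have [-> ->] := infinity_series_pair_even m.
  by rewrite sm; split; lia.
rewrite exprS mulN1r => def_ij.
have [|m [sm sm1]] := IHk (i - 1) (- j); first by rewrite mulrN; lia.
exists (2 * m).+1; have [-> ->] := infinity_series_pair_odd m.
by rewrite sm sm1 subrK opprK.
Qed.

Theorem theorem5 (i j : int) :
  (exists n : nat, infinity_series n = i /\ infinity_series n.+1 = j) <->
  [\/ 0 < i /\ - i <= j <= i - 1,
      [/\ 1 <= j, 1 - j <= i <= j + 1 & (i <> j %[mod 2])%Z]
    | [/\ j <= - 2, j + 2 <= i <= - j - 2 & (i = j %[mod 2])%Z]].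
Proof.
apply: (iff_trans (infinity_series_pairP i j)); split.
  (* Odd [k] means that [i - j] is even and at least [2]; even [k] means that [i + j] is odd and at
     least [1]. *)
  case=> k; rewrite -signr_odd; case: (boolP (odd k)) => k_odd.
    rewrite expr1 mulN1r => def_k.
    have [[i_gt0 j_ge]|] : (0 < i /\ - i <= j) \/ (i <= 0 \/ j < - i) by lia.
      by apply: Or31; lia.
    by move=> ij; apply: Or33; split; lia.
  rewrite expr0 mul1r => def_k.
  have [[j_ge1 i_le]|] : (1 <= j /\ i <= j + 1) \/ (j < 1 \/ j + 1 < i) by lia.
    by apply: Or32; split; lia.
  by move=> ij; apply: Or31; lia.
move=> cases.
(* Case (a) meets both parities: it gives [0 <= i + j] and [1 <= i - j], and parity sharpens the
   relevant bound by one. *)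
have [[ij_odd ij_ge]|[ij_even ij_ge]] :
    ((i <> j %[mod 2])%Z /\ 1 <= i + j) \/ ((i = j %[mod 2])%Z /\ 2 <= i - j).
  by case: cases => [[? ?]|[? ? ?]|[? ? ?]]; lia.
(* Solving [i + j = k + 1] for [k]; the bound makes the absolute value harmless. *)
- exists `|(i + j - 1)%R|%N; rewrite -signr_odd.
  have -> : odd `|(i + j - 1)%R|%N = false by lia.
  by rewrite expr0 mul1r; lia.
- exists `|(i - j - 1)%R|%N; rewrite -signr_odd.
  have -> : odd `|(i - j - 1)%R|%N = true by lia.
  by rewrite expr1 mulN1r; lia.
Qed.
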